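(* Let $F$ be a zippable set functor that preserves intersections, equipped with a subnatural encoding $\flat_X\colon FX\to\mathcal{B}(A\times X)$ for which $F$ has a refinement interface. Then for every finite set $X$ we have $\tau^F_X=\tau^{\mathcal{B}(A\times-)}_X\circ\flat_X$; in particular, for every $F$-coalgebra $c\colon X\to FX$ on a finite set $X$, its canonical graph $\tau^F_X\circ c\colon X\to\mathcal{P}X$ coincides with the canonical graph $\tau^{\mathcal{B}(A\times-)}_X\circ\flat_X\circ c$ of its encoding.
   Context: $\mathcal{B}$ is the bag functor ($\mathcal{B}X$ = finitely supported maps $X\to\mathbb{N}$; $\mathcal{B}f(b)(y)=\sum_{f(x)=y}b(x)$); $\mathcal{P}$ is the powerset. $1=\{*\}$, $!$ the unique map to $1$, $3=\{0,1,2\}$. For $S\subseteq X$, $\mathrm{fil}_S\colon\mathcal{B}(A\times X)\to\mathcal{B}(A)$, $\mathrm{fil}_S(b)(a)=\sum_{x\in S}b(a,x)$. An encoding of $F$ is a label set $A$ with maps $\flat_X\colon FX\to\mathcal{B}(A\times X)$ such that $\langle F!,\flat_X\rangle\colon FX\to F1\times\mathcal{B}(A\times X)$ is injective for each $X$; it is subnatural if $\mathcal{B}(A\times m)\circ\flat_X=\flat_Y\circ Fm$ for every injective $m$. $F$ preserves intersections if it maps pullbacks of pairs of injective maps to pullbacks. $F$ is zippable if $\langle F(A'+!),F(!+B')\rangle\colon F(A'+B')\to F(A'+1)\times F(1+B')$ is injective for all sets $A',B'$. For $S\subseteq C\subseteq X$, $\chi^C_S\colon X\to3$ maps $S$ to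 $2$, $C\setminus S$ to $1$, $X\setminus C$ to $0$. A refinement interface (for $A,\flat$) is a set $W$ with $\mathrm{init}\colon F1\times\mathcal{B}A\to W$, $\mathrm{update}\colon\mathcal{B}A\times W\to W\times F3\times W$ such that for each set $X$ there is $w\colon\mathcal{P}X\to(FX\to W)$ with $\mathrm{init}\circ\langle F!,\mathrm{fil}_X\circ\flat_X\rangle=w(X)$ and $\mathrm{update}\circ\langle\mathrm{fil}_S\circ\flat_X,w(C)\rangle=\langle w(S),F\chi^C_S,w(C\setminus S)\rangle$ for all $S\subseteq C\subseteq X$. For a set functor $G$ and $t\in GX$, $\tau^G_X(t)=\{x\in X\mid t\notin Gi[G(X\setminus\{x\})]\}$ with $i\colon X\setminus\{x\}\hookrightarrow X$ the inclusion. *)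

(* Defs.v *)
(* Sets are types, and subsets of X are elements of [set X]; set functors are
   functors on types and functions. *)
From mathcomp Require Import all_boot finmap.
From mathcomp Require Import boolp classical_sets functions cardinality fsbigop.

Set Implicit Arguments.
Unset Strict Implicit.
Unset Printing Implicit Defensive.

Local Open Scope classical_set_scope.

Record set_functor := SetFunctor {
  fobj :> Type -> Type;
  fmap : forall X Y : Type, (X -> Y) -> fobj X -> fobj Y;
  fmap_id : forall X : Type, @fmap X X id = id;
  fmap_comp : forall (X Y Z : Type) (g : Y -> Z) (f : X -> Y),
    fmap (g \o f) = fmap g \o fmap f }.

Arguments fmap F {X Y} f _ : rename.

Definition bang (X : Type) : X -> unit := fun=> tt.

Definition sum_map (X X' Y Y' : Type) (f : X -> X') (g : Y -> Y')
    (s : X + Y) : X' + Y' :=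
  match s with inl x => inl (f x) | inr y => inr (g y) end.

Definition is_pullback (P X Y Z : Type)
    (p : P -> X) (q : P -> Y) (f : X -> Z) (g : Y -> Z) : Prop :=
  f \o p = g \o q /\
  forall (T : Type) (a : T -> X) (b : T -> Y), f \o a = g \o b ->
    exists! h : T -> P, p \o h = a /\ q \o h = b.

Definition preserves_intersections (F : set_functor) : Prop :=
  forall (P X Y Z : Type) (p : P -> X) (q : P -> Y) (f : X -> Z) (g : Y -> Z),
    injective f -> injective g -> is_pullback p q f g ->
    is_pullback (fmap F p) (fmap F q) (fmap F f) (fmap F g).

Definition zippable (F : set_functor) : Prop :=
  forall A B : Type,
    injective (fun t : F (A + B)%type =>
      (fmap F (sum_map (@id A) (@bang B)) t,
       fmap F (sum_map (@bang A) (@id B)) t)).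

(* [{classic X}] is X itself, with the decidable equality and the choice
   operator that finitely supported functions require. *)
Definition bag (X : Type) := {fsfun {classic X} -> nat with 0}.

(* A finitely supported function is given by its values on a finite set that
   contains its support, here the image of the support of b; by [bag_mapE] and
   [filE], the formulas for the values hold outside that set too. *)
Definition bag_map (X Y : Type) (f : X -> Y) (b : bag X) : bag Y :=
  [fsfun y in [fset (f x : {classic Y}) | x : {classic X} in finsupp b]%fset =>
     \big[addn/0]_(x \in (f @^-1` [set y] : set {classic X})) b x].

Definition fil (A X : Type) (S : set X) (b : bag (A * X)) : bag A :=
  [fsfun a in [fset (ax.1 : {classic A}) | ax : {classic A * X} in finsupp b]%fset =>
     \big[addn/0]_(x \in (S : set {classic X})) b (a, x)].

Lemma bag_mapE (X Y : Type) (f : X -> Y) (b : bag X) (y : Y) :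
  bag_map f b y =
  \big[addn/0]_(x \in (f @^-1` [set y] : set {classic X})) b x.
Proof.
rewrite /bag_map fsfun_fun; case: ifPn => // yNb; rewrite fsbig1 // => x /= fxy.
apply: fsfun_dflt; apply: contra yNb => xb.
by apply/imfsetP; exists x => //=; rewrite fxy.
Qed.

Lemma filE (A X : Type) (S : set X) (b : bag (A * X)) (a : A) :
  fil S b a = \big[addn/0]_(x \in (S : set {classic X})) b (a, x).
Proof.
rewrite /fil fsfun_fun; case: ifPn => // aNb; rewrite fsbig1 // => x _.
apply: fsfun_dflt; apply: contra aNb => xb.
by apply/imfsetP; exists (a, x).
Qed.

Lemma bag_map_seqE (X Y : Type) (f : X -> Y) (b : bag X) (r : {fset {classic X}})
    (y : Y) : (finsupp b `<=` r)%fset ->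
  bag_map f b y = \sum_(x <- r | f x == y :> {classic Y}) b x.
Proof.
move=> br; rewrite bag_mapE fsbig_mkcond (@fsbigTE _ _ _ _ r) /=.
  rewrite [RHS]big_mkcond; apply: eq_bigr => x _.
  rewrite /patch; case: eqP => fxy; first by rewrite mem_set.
  by rewrite memNset.
move=> x xNr; rewrite /patch; case: ifP => // _.
by apply: fsfun_dflt; apply: contra xNr; apply: (fsubsetP br).
Qed.

Lemma bag_map_id (X : Type) : @bag_map X X id = id.
Proof.
apply/funext => b; apply/fsfunP => y.
by rewrite bag_mapE [_ @^-1` _](_ : _ = [set y]) // fsbig_set1.
Qed.

Lemma bag_map_comp (X Y Z : Type) (g : Y -> Z) (f : X -> Y) :
  bag_map (g \o f) = bag_map g \o bag_map f.
Proof.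
apply/funext => b; apply/fsfunP => z.
rewrite /= (@bag_map_seqE _ _ _ _ (finsupp b)) ?fsubset_refl //.
rewrite (@bag_map_seqE _ _ g _
  [fset (f x : {classic Y}) | x : {classic X} in finsupp b]%fset); last exact: finsupp_sub.
under [RHS]eq_bigr => y _ do
  rewrite (@bag_map_seqE _ _ f b (finsupp b)) ?fsubset_refl //.
rewrite (exchange_big_dep (fun x => g (f x) == z :> {classic Z})) /=; last first.
  by move=> y x /eqP gy /eqP fx; rewrite fx gy.
rewrite big_mkcond [RHS]big_mkcond; apply: eq_big_seq => x xb.
case: ifPn => // gfx.
rewrite (@eq_bigl _ _ _ _ _ _ (pred1 (f x : {classic Y}))).
  rewrite -big_filter filter_pred1_uniq ?fset_uniq ?big_seq1 //.
  by apply/imfsetP; exists x.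
move=> y; rewrite /= [RHS]eq_sym; case: (@eqP {classic Y} (f x) y) => [<-|_].
  by rewrite gfx.
by rewrite andbF.
Qed.

Definition lbag_map (A X Y : Type) (f : X -> Y) : bag (A * X) -> bag (A * Y) :=
  bag_map (fun ax : A * X => (ax.1, f ax.2)).

Lemma lbag_map_id (A X : Type) : @lbag_map A X X id = id.
Proof. by rewrite -[RHS]bag_map_id; congr bag_map; apply/funext => -[]. Qed.

Lemma lbag_map_comp (A X Y Z : Type) (g : Y -> Z) (f : X -> Y) :
  @lbag_map A X Z (g \o f) = @lbag_map A Y Z g \o @lbag_map A X Y f.
Proof. by rewrite -bag_map_comp. Qed.

Definition labelled_bag (A : Type) : set_functor :=
  @SetFunctor (fun X => bag (A * X)) (@lbag_map A)
    (@lbag_map_id A) (@lbag_map_comp A).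

Record encoding (F : set_functor) := Encoding {
  label : Type;
  flat : forall X : Type, F X -> labelled_bag label X;
  flat_inj : forall X : Type,
    injective (fun t : F X => (fmap F (@bang X) t, flat t)) }.

Arguments flat {F} e {X} t.

Definition subnatural (F : set_functor) (E : encoding F) : Prop :=
  forall (X Y : Type) (m : X -> Y), injective m ->
    fmap (labelled_bag (label E)) m \o flat E (X := X)
    = flat E (X := Y) \o fmap F m.

(* Meaningful for S included in C. *)
Definition chi (X : Type) (C S : set X) (x : X) : 'I_3 :=
  if x \in S then inord 2 else if x \in C then inord 1 else inord 0.

Record refinement_interface (F : set_functor) (E : encoding F) :=
  RefinementInterface {
    weight : Type;
    ri_init : F unit * bag (label E) -> weight;
    ri_update : bag (label E) * weight -> weight * F 'I_3 * weight;
    ri_spec : forall X : Type, exists w : set X -> F X -> weight,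
      (forall t : F X,
         ri_init (fmap F (@bang X) t, fil [set: X] (flat E t)) = w [set: X] t) /\
      (forall S C : set X, S `<=` C -> forall t : F X,
         ri_update (fil S (flat E t), w C t)
         = (w S t, fmap F (chi C S) t, w (C `\` S) t)) }.

Definition tau (G : set_functor) (X : Type) (t : G X) : set X :=
  [set x | ~ range (fmap G (fun y : {y : X | y <> x} => sval y)) t].

Definition canonical_graph (G : set_functor) (X : Type) (c : X -> G X) :
  X -> set X := @tau G X \o c.

(* Main.v *)
(* If x is not in tau (flat t), then flat t has no elements (a, x), so
   filtering by {x} and by the empty set give the same bag; hence update, applied
   with C and S = {x} or S = set0, yields F (chi C {x}) t = F (chi C set0) t for
   every C containing x. If X has a point y <> x, let f redirect x to y. With
   C = {x, y} this equation reads F (chi C {x}) t = F (chi C {x}) (F f t), while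
   identifying x and y makes t and F f t equal; zippability for
   X = {x, y} + (X \ {x, y}) then gives t = F f t, which comes from F (X \ {x}).
   If X = {x}, the equation says that two maps 1 -> 3 with disjoint images agree
   on t, and preservation of their (empty) intersection puts t in the image of
   F of the empty set. *)
Require Import Defs.
From mathcomp Require Import all_boot finmap.
From mathcomp Require Import boolp classical_sets functions cardinality fsbigop.

Set Implicit Arguments.
Unset Strict Implicit.
Unset Printing Implicit Defensive.

Local Open Scope classical_set_scope.

Lemma fmap_compE (F : set_functor) (X Y Z : Type) (g : Y -> Z) (f : X -> Y)
    (t : F X) : fmap F g (fmap F f t) = fmap F (g \o f) t.
Proof. by rewrite fmap_comp. Qed.

Lemma fil_set0_eq (A X : Type) (b b' : bag (A * X)) :
  fil set0 b = fil set0 b'.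
Proof. by apply/fsfunP => a; rewrite !filE !fsbig_set0. Qed.

(** Every element of [lbag_map m b] has its second component in the range of [m], so all
    multiplicities summed over [S] vanish. *)
Lemma fil_notin_range (A X Y : Type) (m : Y -> X) (S : set X) (b : bag (A * Y)) :
  (forall y, ~ S (m y)) -> fil S (lbag_map m b) = fil set0 (lbag_map m b).
Proof.
move=> Sm; apply/fsfunP => a; rewrite !filE fsbig_set0 fsbig1// => x Sx.
rewrite /lbag_map bag_mapE fsbig1// => -[a' y] /= [_ myx].
by case: (Sm y); rewrite myx.
Qed.

(** [ri_update] gets the same argument for [S] and for [S'], so the middle components of the two
    results agree. *)
Lemma fmap_chi_eq (F : set_functor) (E : encoding F) (X : Type)
    (C S S' : set X) (t : F X) :
  inhabited (refinement_interface E) -> S `<=` C -> S' `<=` C ->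
  fil S (flat E t) = fil S' (flat E t) ->
  fmap F (chi C S) t = fmap F (chi C S') t.
Proof.
move=> [R] SC S'C eqfil; have [w [_ wP]] := ri_spec R X.
by have := wP _ _ SC t; rewrite eqfil (wP _ _ S'C) => -[].
Qed.

Lemma ord3_neq21 : (inord 2 == inord 1 :> 'I_3) = false.
Proof. by rewrite -val_eqE /= !inordK. Qed.

Lemma ord3_neq02 : (inord 0 == inord 2 :> 'I_3) = false.
Proof. by rewrite -val_eqE /= !inordK. Qed.

Lemma ord3_neq01 : (inord 0 == inord 1 :> 'I_3) = false.
Proof. by rewrite -val_eqE /= !inordK. Qed.

Definition redirect (X : Type) (x y z : X) : X :=
  if pselect (z = x) then y else z.

Lemma redirectP (X : Type) (x y : X) : y <> x -> forall z, redirect x y z <> x.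
Proof. by move=> yx z; rewrite /redirect; case: pselect. Qed.

Lemma chi_redirect (X : Type) (x y : X) : y <> x ->
  chi [set x; y] [set x] \o redirect x y = chi [set x; y] set0.
Proof.
move=> yx; apply/funext => z; rewrite /= /chi /redirect in_set0.
case: pselect => zx /=; last by rewrite memNset.
by rewrite zx memNset// !mem_set//; [left|right].
Qed.

(** For [y <> x], the bijection of X with {x, y} + (X \ {x, y}) that makes zippability applicable;
    [true] stands for x and [false] for y. *)
Definition split2 (X : Type) (x y z : X) : bool + {z : X | z <> x /\ z <> y} :=
  match pselect (z = x), pselect (z = y) with
  | left _, _ => inl true
  | right _, left _ => inl false
  | right zx, right zy => inr (exist _ z (conj zx zy))
  end.

Definition unsplit2 (X : Type) (x y : X)
    (s : bool + {z : X | z <> x /\ z <> y}) : X :=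
  match s with inl b => if b then x else y | inr z => sval z end.

Lemma split2K (X : Type) (x y : X) : @unsplit2 X x y \o @split2 X x y = id.
Proof.
apply/funext => z; rewrite /= /split2.
by case: pselect => [zx|zx] //=; case: pselect => [zy|zy].
Qed.

(** Collapsing the rest of X leaves just the blocks that [chi] distinguishes, so F of [chi]
    determines the first component of the zippability map. *)
Lemma split2_chi (X : Type) (x y : X) :
  sum_map id (@bang _) \o @split2 X x y =
  (fun i : 'I_3 => if i == inord 2 then inl true
                   else if i == inord 1 then inl false else inr tt)
    \o chi [set x; y] [set x].
Proof.
apply/funext => z; rewrite /= /split2 /chi.
case: pselect => zx /=; first by rewrite zx mem_set//= eqxx.
rewrite [z \in [set x]]memNset//; case: pselect => zy /=.
  by rewrite zy mem_set /= 1?eq_sym ?ord3_neq21 ?eqxx//; right.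
by rewrite memNset /= ?ord3_neq02 ?ord3_neq01// => -[].
Qed.

(** Once [bool] is collapsed, x and y have the same image, so moving x to y has no effect. *)
Lemma split2_redirect (X : Type) (x y : X) :
  sum_map (@bang _) id \o @split2 X x y \o redirect x y =
  sum_map (@bang _) id \o @split2 X x y.
Proof.
apply/funext => z; rewrite /= /redirect; case: pselect => //= ->.
rewrite /split2; case: (pselect (x = x)) => // _.
by case: (pselect (y = x)) => // ?; case: (pselect (y = y)).
Qed.

Lemma zippable_redirect (F : set_functor) (X : Type) (x y : X) (t : F X) :
  zippable F -> y <> x ->
  fmap F (chi [set x; y] [set x]) t = fmap F (chi [set x; y] set0) t ->
  fmap F (redirect x y) t = t.
Proof.
move=> zipF yx eqchi.
suff eqsplit : fmap F (@split2 X x y) (fmap F (redirect x y) t) =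
               fmap F (@split2 X x y) t.
  have := congr1 (fmap F (@unsplit2 X x y)) eqsplit.
  rewrite (fmap_compE _ (@split2 X x y)) [RHS]fmap_compE split2K.
  by rewrite !fmap_id.
apply: zipF; congr pair; rewrite !fmap_compE; last first.
  by rewrite split2_redirect.
by rewrite split2_chi -compA chi_redirect// fmap_comp /= -eqchi fmap_compE.
Qed.

(** The empty set is the pullback of [f] and [g]; [s] and [t], as maps from [unit], form a cone over
    [fmap F f] and [fmap F g], which factors through [F void]. *)
Lemma intersection_disjoint (F : set_functor) (X Y Z : Type)
    (f : X -> Z) (g : Y -> Z) (s : F X) (t : F Y) :
  preserves_intersections F -> injective f -> injective g ->
  (forall x y, f x <> g y) -> fmap F f s = fmap F g t ->
  exists u : F void, fmap F (of_void X) u = s.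
Proof.
move=> capF f_inj g_inj fg eqst.
have pb : is_pullback (of_void X) (of_void Y) f g.
  split=> [|T a b ab]; first by apply/funext => -[].
  have T0 (z : T) : False by exact: (fg _ _ (congr1 (@^~ z) ab)).
  exists (fun z => False_rect _ (T0 z)).
  by split=> [|h _]; [split|]; apply/funext => z; case: (T0 z).
have [_ /(_ unit (fun=> s) (fun=> t))] := capF _ _ _ _ _ _ _ _ f_inj g_inj pb.
case=> [|h [[hs _] _]]; first exact/funext.
by exists (h tt); exact: (congr1 (@^~ tt) hs).
Qed.

Lemma subsingleton_range (F : set_functor) (X : Type) (x : X) (t : F X) :
  preserves_intersections F -> (forall y, y = x) ->
  fmap F (chi [set: X] [set x]) t = fmap F (chi [set: X] set0) t ->
  range (fmap F (fun y : {y : X | y <> x} => sval y)) t.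
Proof.
move=> capF Xx eqchi.
have X_inj (f : X -> 'I_3) : injective f by move=> y z _; rewrite (Xx y) (Xx z).
have [|u <-] := intersection_disjoint capF (X_inj _) (X_inj _) _ eqchi.
  move=> y z; rewrite /chi (Xx y) in_set0 !mem_set//.
  by move=> /eqP; rewrite ord3_neq21.
exists (fmap F (of_void _) u) => //; rewrite fmap_compE.
by congr (fmap F _ u); apply/funext => -[].
Qed.

Lemma range_avoiding (F : set_functor) (E : encoding F) (X : Type) (x : X)
    (t : F X) :
  zippable F -> preserves_intersections F ->
  inhabited (refinement_interface E) ->
  fil [set x] (flat E t) = fil set0 (flat E t) ->
  range (fmap F (fun y : {y : X | y <> x} => sval y)) t.
Proof.
move=> zipF capF R fil0.
have eqchi C : C x -> fmap F (chi C [set x]) t = fmap F (chi C set0) t.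
  by move=> Cx; apply: fmap_chi_eq R _ _ fil0 => // _ ->.
have [[y yx]|Xx] := pselect (exists y, y <> x); last first.
  apply: subsingleton_range => //; last exact: eqchi.
  by move=> y; apply: contrapT => yx; apply: Xx; exists y.
have <- : fmap F (redirect x y) t = t.
  by apply: zippable_redirect => //; apply: eqchi; left.
(* [redirect x y] avoids x, so it factors through the inclusion of X \ {x}. *)
exists (fmap F (fun z => exist _ (redirect x y z) (redirectP yx (z := z))) t) => //.
by rewrite fmap_compE.
Qed.

Theorem theorem40 (F : set_functor) (E : encoding F) :
  zippable F ->
  preserves_intersections F ->
  subnatural E ->
  inhabited (refinement_interface E) ->
  forall X : Type, finite_set [set: X] ->
    @tau F X = @tau (labelled_bag (label E)) X \o flat E (X := X) /\
    forall c : X -> F X,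
      canonical_graph c
      = @canonical_graph (labelled_bag (label E)) X (flat E (X := X) \o c).
Proof.
move=> zipF capF natE R X _.
suff eqtau : @tau F X = @tau (labelled_bag (label E)) X \o flat E (X := X).
  by split=> // c; rewrite /canonical_graph eqtau.
apply/funext => t; apply/seteqP; split=> x /=; rewrite /tau /=; apply: contra_not.
  move=> [b _ bt]; apply: (range_avoiding zipF capF R).
  by rewrite -bt; apply: fil_notin_range => -[y].
(* Conversely, subnaturality for the inclusion of X \ {x} carries a preimage under F to one of the
   encoded bag. *)
move=> [s _ <-]; exists (flat E s) => //.
have sval_inj : injective (fun y : {y : X | y <> x} => sval y).
  by move=> [y yx] [z zx] /= yz; apply: eq_exist.
exact: (congr1 (@^~ s) (natE _ _ _ sval_inj)).
Qed.
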